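(* Let $X$ be a locally compact, connected Hausdorff space. The sum of two proper deficient topological measures on $X$ is a proper deficient topological measure on $X$.
   Context: $\mathscr{O}(X)$, $\mathscr{C}(X)$, $\mathscr{K}(X)$ denote the collections of open, closed, compact subsets of $X$; $\sqcup$ denotes a disjoint union. Set functions into the extended reals are assumed not identically $\infty$. A deficient topological measure is $\nu:\mathscr{C}(X)\cup\mathscr{O}(X)\to[0,\infty]$ such that: $\nu(C\sqcup K)=\nu(C)+\nu(K)$ for disjoint compact $C,K$; $\nu(U)=\sup\{\nu(C): C\subseteq U, C\in\mathscr{K}(X)\}$ for $U$ open; $\nu(F)=\inf\{\nu(U): F\subseteq U, U\in\mathscr{O}(X)\}$ for $F$ closed. A Radon measure is a Borel measure that is finite on compact sets, outer regular on all Borel sets (by open sets), and inner regular on all open sets (by compact sets). A deficient topological measure $\nu$ is proper if $m\le\nu$ on $\mathscr{O}(X)\cup\mathscr{C}(X)$ with $m$ a Radon measure implies $m=0$. *)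

(* Defs.v *)
From HB Require Import structures.
From mathcomp Require Import all_boot all_order all_algebra.
From mathcomp Require Import all_classical all_reals all_analysis.

Set Implicit Arguments.
Unset Strict Implicit.
Unset Printing Implicit Defensive.

Local Open Scope classical_set_scope.
Local Open Scope ring_scope.
Local Open Scope ereal_scope.

Definition open_or_closed {X : topologicalType} (A : set X) : Prop :=
  open A \/ closed A.

(* A set function on the open and closed sets of X is encoded by a total
   function on [set X]; its values at other sets are never used. *)
Record deficient_topological_measure {R : realType} {X : topologicalType}
    (nu : set X -> \bar R) : Prop := DeficientTopologicalMeasure {
  dtm_ge0 : forall A, open_or_closed A -> 0 <= nu A ;
  dtm_not_infty : exists2 A, open_or_closed A & nu A <> +oo ;
  dtm_additive : forall C K, compact C -> compact K -> C `&` K = set0 ->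
    nu (C `|` K) = nu C + nu K ;
  dtm_inner : forall U, open U ->
    nu U = ereal_sup [set nu C | C in [set C | compact C /\ C `<=` U]] ;
  dtm_outer : forall F, closed F ->
    nu F = ereal_inf [set nu U | U in [set U | open U /\ F `<=` U]]
}.

(* Measurable types are pointed in the library, so X has to be pointed for its
   Borel sets to form one; only the empty space is excluded. *)
Definition borelType (X : ptopologicalType) := g_sigma_algebraType (@open X).

HB.instance Definition _ (X : ptopologicalType) := Measurable.on (borelType X).

Record radon_measure {R : realType} {X : ptopologicalType}
    (m : {measure set (borelType X) -> \bar R}) : Prop := RadonMeasure {
  radon_compact : forall K : set X, compact K -> m K < +oo ;
  radon_outer : forall B : set (borelType X), measurable B ->
    m B = ereal_inf [set m U | U in [set U : set X | open U /\ B `<=` U]] ;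
  radon_inner : forall U : set X, open U ->
    m U = ereal_sup [set m K | K in [set K : set X | compact K /\ K `<=` U]]
}.

Definition proper_deficient_topological_measure {R : realType}
    {X : ptopologicalType} (nu : set X -> \bar R) : Prop :=
  deficient_topological_measure nu /\
  forall m : {measure set (borelType X) -> \bar R}, radon_measure m ->
    (forall A : set X, open_or_closed A -> m A <= nu A) ->
    forall B : set (borelType X), measurable B -> m B = 0.

(* Main.v *)
From HB Require Import structures.
Require Import Defs.
From mathcomp Require Import all_boot all_order all_algebra.
From mathcomp Require Import all_classical all_reals all_analysis.

(** Throughout, [mu] and [nu] are deficient topological measures.

    That [mu + nu] is again a deficient topological measure is a matter of
    exchanging sums with suprema and infima, which is allowed because compact
    sets are directed upwards and open neighbourhoods downwards ([dtm_add]).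

    For properness, let [m <= mu + nu] be a Radon measure and fix a compact
    set [K]; the point is to show [m K = 0].  Extend [mu] to all sets by
    approximation from inside by compact sets, and cut it off by the finite
    measure [m (_ `&` K)]:
      [a B = min (m (B `&` K)) (sup of mu over the compact subsets of B)].
    The function [a] is superadditive on disjoint Borel sets.  For a
    superadditive function the infimum of the sums [\sum_i a (F i)] over
    countable Borel covers, [mu_ext a], is not just an outer measure: cutting
    a cover along a Borel set [B] can only decrease its sum, so [B] satisfies
    the Caratheodory condition, and [mu_ext a] is a measure on the Borel sets
    ([mu_ext_measure]).  It lies below [m (_ `&` K)], hence is Radon
    ([dominated_radon]), and it lies below [mu].  Since [mu] is proper, it
    vanishes ([proper_truncated_dtm_eq0]).  The same construction from [nu]
    gives [b] with [mu_ext b = 0].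

    On the other hand, inner regularity of [m] yields
    [m (B `&` K) <= a B + b B] for all Borel [B] ([le_truncated_dtmD]).  A
    measure lying below a sum of two superadditive functions still lies below
    the sum when one of them is replaced by its infimum over covers
    ([le_add_mu_ext]).  Doing so for [b] and then for [a] gives
    [m (B `&` K) <= mu_ext a B + mu_ext b B = 0]. *)

Set Implicit Arguments.
Unset Strict Implicit.
Unset Printing Implicit Defensive.
Import Order.TTheory GRing.Theory Num.Theory.

Local Open Scope classical_set_scope.
Local Open Scope ring_scope.
Local Open Scope ereal_scope.

(** * Sums of extended reals with infima, suprema and minima *)

Section ereal_bounds.
Variable R : realType.
Implicit Types (S : set (\bar R)) (a y : \bar R).

Lemma le_add_ereal_inf S a y : 0 <= a -> (forall x, S x -> 0 <= x) ->
  (forall x, S x -> y <= a + x) -> y <= a + ereal_inf S.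
Proof.
move=> a0 S0 yS; have inf0 : 0 <= ereal_inf S by exact: le_ereal_inf_tmp.
have [->|infoo] := eqVneq (ereal_inf S) +oo.
  by rewrite addey ?leey// gt_eqF// (lt_le_trans _ a0)// ltNy0.
apply/lee_addgt0Pr => e e0.
have /(lb_ereal_inf_adherent e0)[x Sx xe] : ereal_inf S \is a fin_num.
  by rewrite ge0_fin_numE// lt_neqAle infoo leey.
by apply: (le_trans (yS _ Sx)); rewrite -addeA leeD2l// ltW.
Qed.

Lemma ge_add_ereal_sup S a y : 0 <= a -> S !=set0 ->
  (forall x, S x -> 0 <= x) ->
  (forall x, S x -> a + x <= y) -> a + ereal_sup S <= y.
Proof.
move=> a0 [s Ss] S0 yS; have [aoo|afin] := eqVneq a +oo.
  have := yS _ Ss.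
  rewrite aoo addye ?gt_eqF ?(lt_le_trans _ (S0 _ Ss)) ?ltNy0//.
  by move=> yoo; exact: le_trans (leey _) yoo.
have af : a \is a fin_num by rewrite ge0_fin_numE// lt_neqAle afin leey.
rewrite -leeBrDl//; apply: ge_ereal_sup => x Sx.
by rewrite leeBrDl//; exact: yS.
Qed.

Lemma le_minD (m a b : \bar R) : 0 <= m -> 0 <= a -> 0 <= b -> m <= a + b ->
  m <= Order.min m a + Order.min m b.
Proof.
move=> m0 a0 b0 mab; have [ma|am] := leP m a.
  by rewrite leeDl// le_min m0 b0.
by have [mb|bm] := leP m b; [rewrite leeDr|].
Qed.

End ereal_bounds.

(** * Measures generated by superadditive set functions *)

Section superadditive_envelope.
Context d (T : measurableType d) (R : realType).
Implicit Types (lam a b : set T -> \bar R).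

Definition superadditive lam := forall A B, measurable A -> measurable B ->
  A `&` B = set0 -> lam A + lam B <= lam (A `|` B).

Lemma superadditive_le lam : (forall A, 0 <= lam A) -> superadditive lam ->
  forall A B, measurable A -> measurable B -> A `<=` B -> lam A <= lam B.
Proof.
move=> lam0 lamD A B mA mB AB; rewrite -(setDUK AB).
apply: le_trans (lamD _ _ mA (measurableD mB mA) _); first by rewrite leeDl.
by rewrite setDIK.
Qed.

Lemma superadditive_series lam : lam set0 = 0 -> (forall A, 0 <= lam A) ->
  superadditive lam -> forall (F : (set T)^nat) B,
  (forall i, measurable (F i)) ->
  trivIset setT F -> measurable B -> (forall i, F i `<=` B) ->
  \sum_(i <oo) lam (F i) <= lam B.
Proof.
move=> lamE lam0 lamD F B mF tF mB FB.
apply: lime_le; first exact: is_cvg_nneseries.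
apply: nearW => n; rewrite big_mkord.
apply: (@le_trans _ _ (lam (\big[setU/set0]_(i < n) F i))); last first.
  apply: superadditive_le => //; first exact: bigsetU_measurable.
  by rewrite -bigcup_mkord; exact: bigcup_sub.
elim: n => [|n IH]; first by rewrite !big_ord0 lamE.
rewrite !big_ord_recr /=.
apply: (le_trans (leeD2r _ IH)); apply: lamD => //.
  exact: bigsetU_measurable.
by apply: (@trivIset_bigsetUI _ predT) => //; rewrite /predT /= trueE.
Qed.

Lemma mu_ext_le lam B : lam set0 = 0 -> measurable B -> mu_ext lam B <= lam B.
Proof.
move=> lamE mB; apply: ereal_inf_lbound.
exists (fun n => if n is 0%N then B else set0).
  by split=> [[]// _|t Bt]; exists 0%N.
apply/cvg_lim => //; rewrite -cvg_shiftS.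
rewrite (_ : [sequence _]_n = cst (lam B)); first exact: cvg_cst.
by rewrite funeqE => n /=; rewrite big_nat_recl//= big1 ?adde0.
Qed.

(** Superadditivity is exactly what makes every measurable set [B] split the
    outer measure: if [F] covers [E], then the sets [F i `&` B] cover
    [E `&` B], the sets [F i `&` ~` B] cover [E `&` ~` B], and by
    superadditivity the two sums together do not exceed the sum for [F]. *)
Lemma mu_ext_measure lam : lam set0 = 0 -> (forall A, 0 <= lam A) ->
  superadditive lam ->
  exists m : {measure set T -> \bar R}, forall A, m A = mu_ext lam A.
Proof.
move=> lamE lam0 lamD.
pose out := isOuterMeasure.Build R T (mu_ext lam) (mu_ext0 lamE lam0)
  (mu_ext_ge0 lam0) (@le_mu_ext _ _ _ lam) (mu_ext_sigma_subadditive lam0).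
pose O : {outer_measure set T -> \bar R} := HB.pack (mu_ext lam) out.
have cara (B : set T) : measurable B -> caratheodory_measurable O B.
  move=> mB; apply: le_caratheodory_measurable => X /=.
  apply: le_ereal_inf_tmp => _ [F [mF XF] <-].
  apply: (@le_trans _ _ (\sum_(i <oo) lam (F i `&` B) +
                         \sum_(i <oo) lam (F i `&` ~` B))).
    apply: leeD; apply: ereal_inf_lbound.
    - exists (fun i => F i `&` B) => //; split=> [i|]; first exact: measurableI.
      by rewrite -setI_bigcupl; exact: setSI.
    - exists (fun i => F i `&` ~` B) => //; split=> [i|].
        by apply: measurableI => //; exact: measurableC.
      by rewrite -setI_bigcupl; exact: setSI.
  rewrite -nneseriesD//; apply: lee_nneseries => [i _ _|i _].
    exact: adde_ge0.
  rewrite -[in leRHS](setIT (F i)) -(setUv B) setIUr; apply: lamD.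
  - exact: measurableI.
  - by apply: measurableI => //; exact: measurableC.
  - by rewrite setIACA setICr setI0.
have add : semi_sigma_additive (mu_ext lam : set T -> \bar R).
  move=> F mF tF mUF; apply: (@caratheodory_measure_sigma_additive _ _ O) => //.
    by move=> i; exact: cara.
  exact: cara.
pose mm := isMeasure.Build d T R (mu_ext lam) (mu_ext0 lamE lam0)
  (mu_ext_ge0 lam0) add.
pose M : {measure set T -> \bar R} := HB.pack (mu_ext lam) mm.
by exists M.
Qed.

(** Given a cover [F] of [B], make it disjoint and cut it down to [B], giving
    pieces [G i].  Countable additivity of [m] and the hypothesis on each
    piece bound [m B] by [\sum_i a (G i) + \sum_i b (G i)]; the first sum is
    at most [a B] because [a] is superadditive and the [G i] are disjoint in
    [B], the second at most [\sum_i b (F i)] because [b] is monotone. *)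
Lemma le_add_mu_ext (m : {measure set T -> \bar R}) a b :
  a set0 = 0 -> (forall A, 0 <= a A) -> superadditive a ->
  (forall A, 0 <= b A) -> superadditive b ->
  (forall B, measurable B -> m B <= a B + b B) ->
  forall B, measurable B -> m B <= a B + mu_ext b B.
Proof.
move=> aE a0 aD b0 bD mab B mB; apply: le_add_ereal_inf => //.
  by move=> _ [F _ <-]; exact: nneseries_ge0.
move=> _ [F [mF BF] <-]; pose G := seqDU (fun i => B `&` F i).
have mG i : measurable (G i).
  by apply: seqDU_measurable => j; exact: measurableI.
have tG : trivIset setT G by exact: trivIset_seqDU.
have BG : \bigcup_i G i = B.
  by rewrite -seqDU_bigcup_eq -setI_bigcupr; exact: setIidl.
have GB i : G i `<=` B by rewrite -BG; exact: bigcup_sup.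
rewrite -{1}BG measure_semi_bigcup ?BG//.
apply: (@le_trans _ _ (\sum_(i <oo) (a (G i) + b (G i)))).
  by apply: lee_nneseries => // i _; exact: mab.
rewrite nneseriesD//; apply: leeD.
  exact: superadditive_series.
apply: lee_nneseries => // i _; apply: superadditive_le => //.
by apply: subset_trans (@subset_seqDU _ _ _) _; exact: subIsetr.
Qed.

End superadditive_envelope.

(** * Radon measures *)

Section radon.
Context (R : realType) (X : ptopologicalType) (hX : hausdorff_space X).
Implicit Types (A B C F K U V : set X).
Implicit Types (m p : {measure set (borelType X) -> \bar R}).

Lemma open_borel U : open U -> measurable (U : set (borelType X)).
Proof. by move=> oU; exact: sub_sigma_algebra. Qed.

Lemma closed_borel F : closed F -> measurable (F : set (borelType X)).
Proof.
move=> cF; rewrite -[F]setCK; apply: measurableC.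
exact: open_borel (closed_openC cF).
Qed.

Lemma compact_borel K : compact K -> measurable (K : set (borelType X)).
Proof. by move=> cK; apply: closed_borel; exact: compact_closed. Qed.

(** Inner regularity at sets of finite measure, which comes from outer
    regularity at the complement: if the open set [V] contains [K `\` B] and
    has almost the same measure, then [K `\` V] is compact and fills up
    almost all of [B `&` K]. *)
Lemma radon_compact_approx m K (B : set (borelType X)) (e : R) :
  radon_measure m -> compact K -> measurable B -> (0 < e)%R ->
  exists C, [/\ compact C, C `<=` B `&` K & m ((B `&` K) `\` C) <= e%:E].
Proof.
move=> rm cK mB e0; have mK := compact_borel cK.
have mKB : measurable ((K : set (borelType X)) `\` B) by exact: measurableD.
have KBfin : m (K `\` B) \is a fin_num.
  rewrite ge0_fin_numE//; apply: le_lt_trans (radon_compact rm cK).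
  by apply: le_measure; rewrite ?inE//; exact: subDsetl.
have := KBfin; rewrite (radon_outer rm mKB).
move=> /(lb_ereal_inf_adherent e0)[_ [V [oV KBV] <-]].
rewrite -(radon_outer rm mKB) => mV.
have mVb := open_borel oV.
have cC : compact (K `\` V).
  apply: (@subclosed_compact _ _ K); [|by []|exact: subDsetl].
  by apply: closedI; [exact: compact_closed|exact: open_closedC].
exists (K `\` V); split => //.
  move=> x [Kx nVx]; split => //; apply: contrapT => nBx.
  by apply: nVx; exact: KBV.
apply: (@le_trans _ _ (m (V `\` (K `\` B)))).
  apply: le_measure; rewrite ?inE.
  - by apply: measurableD; [exact: measurableI|exact: compact_borel].
  - exact: measurableD.
  - move=> x [[Bx Kx] nC]; split; last by case.
    by apply: contrapT => nVx; apply: nC.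
rewrite -(leeD2rE _ _ KBfin) (addeC e%:E); apply: le_trans (ltW mV).
by rewrite (measureDI m mVb mKB) (setIidr KBV).
Qed.

(** Sets that approximate for the finite measure [m (_ `&` K)] approximate at
    least as well for the smaller measure [p]. *)
Lemma dominated_radon m p K : radon_measure m -> compact K ->
  (forall B : set (borelType X), measurable B -> p B <= m (B `&` K)) ->
  radon_measure p.
Proof.
move=> rm cK pm; have mK := compact_borel cK; split.
- move=> K' cK'; have mK' := compact_borel cK'.
  apply: (le_lt_trans (pm _ mK')); apply: le_lt_trans (radon_compact rm cK).
  by apply: le_measure; rewrite ?inE//; exact: measurableI.
- move=> B mB; apply/eqP; rewrite eq_le; apply/andP; split.
    apply: le_ereal_inf_tmp => _ [U [oU BU] <-].
    by apply: le_measure; rewrite ?inE//; exact: open_borel.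
  apply/lee_addgt0Pr => e e0.
  (* The complement of a compact set approximating ~` B from inside is an open
     set approximating B from outside. *)
  have [C [cC CBK mC]] := radon_compact_approx rm cK (measurableC mB) e0.
  have oU : open (~` C) by apply: closed_openC; exact: compact_closed.
  have BU : B `<=` ~` C by move=> x Bx /CBK[].
  apply: ge_ereal_inf; exists (p (~` C)); first by exists (~` C).
  rewrite (measureDI p (open_borel oU) mB) (setIidr BU) addeC leeD2l//.
  apply: le_trans mC.
  have -> : (~` B `&` K) `\` C = (~` C `\` B) `&` K.
    by rewrite !setDE; apply/seteqP; split=> x /=; tauto.
  by apply: pm; apply: measurableD => //; exact: open_borel.
- move=> U oU; have mU := open_borel oU.
  apply/eqP; rewrite eq_le; apply/andP; split; last first.
    apply: ge_ereal_sup => _ [C [cC CU] <-].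
    by apply: le_measure; rewrite ?inE//; exact: compact_borel.
  apply/lee_addgt0Pr => e e0.
  have [C [cC CUK mC]] := radon_compact_approx rm cK mU e0.
  have mCb := compact_borel cC.
  have CU : C `<=` U by move=> x /CUK[].
  rewrite (measureDI p mU mCb) (setIidr CU) addeC; apply: leeD.
    by apply: ereal_sup_ubound; exists C.
  apply: le_trans mC; rewrite -setIDA -setIDAC.
  by apply: pm; exact: measurableD.
Qed.

Lemma radon_eq0 m : radon_measure m -> (forall K, compact K -> m K = 0) ->
  forall B : set (borelType X), measurable B -> m B = 0.
Proof.
move=> rm mK B mB; apply/eqP; rewrite eq_le measure_ge0 andbT.
apply: (@le_trans _ _ (m setT)); first by apply: le_measure; rewrite ?inE.
rewrite (radon_inner rm openT); apply: ge_ereal_sup => _ [K [cK _] <-].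
by rewrite mK.
Qed.

End radon.

(** * Deficient topological measures *)

Section dtm.
Context (R : realType) (X : ptopologicalType) (hX : hausdorff_space X).
Implicit Types (A B C F K U V : set X) (mu nu : set X -> \bar R).

Lemma dtm_le_open mu A U : deficient_topological_measure mu ->
  open_or_closed A -> open U -> A `<=` U -> mu A <= mu U.
Proof.
move=> dmu [oA|cA] oU AU.
  rewrite (dtm_inner dmu oA) (dtm_inner dmu oU); apply: ereal_sup_le.
  move=> _ [C [cC CA] <-]; exists C => //; split => //.
  exact: subset_trans AU.
by rewrite (dtm_outer dmu cA); apply: ereal_inf_lbound; exists U.
Qed.

Lemma dtm_le mu A B : deficient_topological_measure mu ->
  open_or_closed A -> open_or_closed B -> A `<=` B -> mu A <= mu B.
Proof.
move=> dmu ocA [oB|cB] AB; first exact: dtm_le_open.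
rewrite (dtm_outer dmu cB); apply: le_ereal_inf_tmp => _ [U [oU BU] <-].
by apply: dtm_le_open => //; exact: subset_trans BU.
Qed.

Lemma compact_open_or_closed K : compact K -> open_or_closed K.
Proof. by right; exact: compact_closed. Qed.

(** Additivity leaves only the values [0] and [+oo], and the second is
    excluded by monotonicity and the existence of a set of finite value. *)
Lemma dtm0 mu : deficient_topological_measure mu -> mu set0 = 0.
Proof.
move=> dmu; have oc0 : @open_or_closed X set0 by left; exact: open0.
have [A ocA Aoo] := dtm_not_infty dmu.
have mu0_fin : mu set0 \is a fin_num.
  rewrite ge0_fin_numE ?(dtm_ge0 dmu)//.
  apply: le_lt_trans (dtm_le dmu oc0 ocA (@sub0set _ A)) _.
  by rewrite ltey; exact/eqP.
have := dtm_additive dmu (@compact0 X) (@compact0 X) (setI0 _).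
rewrite setU0 -(fineK mu0_fin) -EFinD => -[mu0E]; congr EFin.
by apply: (@addrI _ (fine (mu set0))); rewrite addr0 -mu0E.
Qed.

(** The only inequalities that need an argument bound [mu + nu] at a set by a
    single supremum or infimum: separate approximations for [mu] and [nu] are
    merged into the union of two compact sets, respectively the intersection
    of two open neighbourhoods. *)
Lemma dtm_add mu nu : deficient_topological_measure mu ->
  deficient_topological_measure nu ->
  deficient_topological_measure (fun A => mu A + nu A).
Proof.
move=> dmu dnu; have [ge0mu ge0nu] := (dtm_ge0 dmu, dtm_ge0 dnu).
have oc0 : @open_or_closed X set0 by left; exact: open0.
split.
- by move=> A ocA; exact: adde_ge0 (ge0mu _ ocA) (ge0nu _ ocA).
- by exists set0; rewrite ?dtm0// adde0.
- move=> C K cC cK CK.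
  by rewrite (dtm_additive dmu cC cK CK) (dtm_additive dnu cC cK CK) addeACA.
- move=> U oU; have ocU : open_or_closed U by left.
  apply/eqP; rewrite eq_le; apply/andP; split; last first.
    apply: ge_ereal_sup => _ [C [cC CU] <-].
    by have ocC := compact_open_or_closed cC; apply: leeD; apply: dtm_le.
  rewrite [nu U](dtm_inner dnu oU); apply: ge_add_ereal_sup.
  + exact: ge0mu.
  + by exists (nu set0); exists set0 => //; split; [exact: compact0|].
  + by move=> _ [C [cC _] <-]; exact/ge0nu/compact_open_or_closed.
  move=> _ [C [cC CU] <-]; rewrite addeC [mu U](dtm_inner dmu oU).
  apply: ge_add_ereal_sup.
  + exact/ge0nu/compact_open_or_closed.
  + by exists (mu set0); exists set0 => //; split; [exact: compact0|].
  + by move=> _ [D [cD _] <-]; exact/ge0mu/compact_open_or_closed.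
  move=> _ [D [cD DU] <-]; have cDC := compactU cD cC.
  apply: (@le_trans _ _ (mu (D `|` C) + nu (D `|` C))).
    rewrite addeC; apply: leeD; apply: dtm_le => //;
      by [exact: compact_open_or_closed|exact: subsetUl|exact: subsetUr].
  apply: ereal_sup_ubound; exists (D `|` C) => //; split => //.
  by rewrite subUset.
- move=> F cF; have ocF : open_or_closed F by right.
  apply/eqP; rewrite eq_le; apply/andP; split.
    apply: le_ereal_inf_tmp => _ [U [oU FU] <-].
    by have ocU : open_or_closed U by [left]; apply: leeD; apply: dtm_le.
  rewrite [nu F](dtm_outer dnu cF); apply: le_add_ereal_inf.
  + exact: ge0mu.
  + by move=> _ [V [oV _] <-]; apply: ge0nu; left.
  move=> _ [V [oV FV] <-]; rewrite addeC [mu F](dtm_outer dmu cF).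
  apply: le_add_ereal_inf.
  + by apply: ge0nu; left.
  + by move=> _ [U [oU _] <-]; apply: ge0mu; left.
  move=> _ [U [oU FU] <-]; have oUV := openI oU oV.
  apply: (@le_trans _ _ (mu (U `&` V) + nu (U `&` V))).
    apply: ereal_inf_lbound; exists (U `&` V) => //; split => //.
    by rewrite subsetI.
  by rewrite addeC; apply: leeD; apply: dtm_le => //; left.
Qed.

Definition inner_extension mu A :=
  ereal_sup [set mu C | C in [set C | compact C /\ C `<=` A]].

Lemma inner_extension_ge0 mu A : deficient_topological_measure mu ->
  0 <= inner_extension mu A.
Proof.
move=> dmu; rewrite -(dtm0 dmu); apply: ereal_sup_ubound.
by exists set0 => //; split; [exact: compact0|].
Qed.

Lemma inner_extensionD mu A B : deficient_topological_measure mu -> A `&` B = set0 ->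
  inner_extension mu A + inner_extension mu B <= inner_extension mu (A `|` B).
Proof.
move=> dmu AB; have mu0 C : compact C -> 0 <= mu C.
  by move=> cC; exact/(dtm_ge0 dmu)/compact_open_or_closed.
have ex0 A' : [set mu C | C in [set C | compact C /\ C `<=` A']] !=set0.
  by exists (mu set0); exists set0 => //; split; [exact: compact0|].
apply: ge_add_ereal_sup => //; first exact: inner_extension_ge0.
  by move=> _ [C [cC _] <-]; exact: mu0.
move=> _ [D [cD DB] <-]; rewrite addeC; apply: ge_add_ereal_sup => //.
- exact: mu0.
- by move=> _ [C [cC _] <-]; exact: mu0.
move=> _ [C [cC CA] <-]; rewrite addeC -(dtm_additive dmu)//.
  apply: ereal_sup_ubound; exists (C `|` D) => //; split; first exact: compactU.
  exact: setUSS.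
by apply: subsetI_eq0 CA DB AB.
Qed.

Lemma inner_extension_le mu A : deficient_topological_measure mu ->
  open_or_closed A -> inner_extension mu A <= mu A.
Proof.
move=> dmu ocA; apply: ge_ereal_sup => _ [C [cC CA] <-].
by apply: dtm_le => //; exact: compact_open_or_closed.
Qed.

(** * Truncations and properness *)

Section truncation.
Variables (m : {measure set (borelType X) -> \bar R}) (K : set X).
Hypotheses (rm : radon_measure m) (cK : compact K).

(** Truncating by [m (_ `&` K)] keeps the generated measure finite and Radon
    even where [mu] is infinite or not regular on Borel sets. *)
Definition truncated_dtm mu (A : set (borelType X)) :=
  Order.min (m (A `&` K)) (inner_extension mu A).

Lemma truncated_dtm_ge0 mu A : deficient_topological_measure mu ->
  0 <= truncated_dtm mu A.
Proof. by move=> dmu; rewrite le_min measure_ge0 inner_extension_ge0. Qed.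

Lemma truncated_dtm0 mu : deficient_topological_measure mu ->
  truncated_dtm mu set0 = 0.
Proof.
by move=> dmu; rewrite /truncated_dtm set0I measure0 min_l// inner_extension_ge0.
Qed.

(** A minimum of superadditive functions is superadditive. *)
Lemma superadditive_truncated_dtm mu : deficient_topological_measure mu ->
  superadditive (truncated_dtm mu).
Proof.
move=> dmu A B mA mB AB; have mK := compact_borel hX cK.
rewrite [leRHS]/truncated_dtm le_min; apply/andP; split.
  rewrite setIUl measureU; [|exact: measurableI|exact: measurableI|].
    by apply: leeD; rewrite ge_min lexx.
  by rewrite setIACA AB set0I.
apply: le_trans (inner_extensionD dmu AB).
by apply: leeD; rewrite ge_min lexx orbT.
Qed.

(** The measure generated by the truncation is Radon and lies below [mu], so
    properness forces it to vanish. *)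
Lemma proper_truncated_dtm_eq0 mu : proper_deficient_topological_measure mu ->
  forall B : set (borelType X), measurable B -> mu_ext (truncated_dtm mu) B = 0.
Proof.
move=> [dmu pmu] B mB; have l0 := truncated_dtm0 dmu.
have [p pE] := mu_ext_measure l0 (fun A => truncated_dtm_ge0 A dmu)
  (superadditive_truncated_dtm dmu).
have ple (A : set (borelType X)) : measurable A -> p A <= truncated_dtm mu A.
  by move=> mA; rewrite pE; exact: mu_ext_le.
rewrite -pE; apply: pmu => //.
  apply: (dominated_radon hX rm cK) => A mA; apply: (le_trans (ple _ mA)).
  by rewrite ge_min lexx.
move=> A ocA; have mA : measurable (A : set (borelType X)).
  by case: ocA; [exact: open_borel|exact: closed_borel].
apply: (le_trans (ple _ mA)); apply: le_trans (inner_extension_le dmu ocA).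
by rewrite ge_min lexx orbT.
Qed.

(** The bound [m <= mu + nu] is only known on open and closed sets; it passes
    to Borel sets through compact sets almost filling [B `&` K].  Truncation
    does no harm because [m <= s + t] implies [m <= min m s + min m t] for
    nonnegative values. *)
Lemma le_truncated_dtmD mu nu (B : set (borelType X)) :
  deficient_topological_measure mu -> deficient_topological_measure nu ->
  (forall A, open_or_closed A -> m A <= mu A + nu A) -> measurable B ->
  m (B `&` K) <= truncated_dtm mu B + truncated_dtm nu B.
Proof.
move=> dmu dnu mle mB; apply: le_minD; rewrite ?inner_extension_ge0//.
apply/lee_addgt0Pr => e e0; have mK := compact_borel hX cK.
have [C [cC CBK mC]] := radon_compact_approx hX rm cK mB e0.
rewrite (measureDI m (measurableI _ _ mB mK) (compact_borel hX cC)).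
rewrite (setIidr CBK) addeC; apply: leeD => //.
apply: (le_trans (mle _ (compact_open_or_closed cC))).
by apply: leeD; apply: ereal_sup_ubound; exists C => //; split=> // x /CBK[].
Qed.

End truncation.

(** The replacement of a superadditive function by the measure it generates is
    applied twice: to the truncation of [nu], which removes it from the bound
    on [m (_ `&` K)], and then to that of [mu], with [0] as the other
    summand. *)
Lemma proper_dtm_add mu nu : proper_deficient_topological_measure mu ->
  proper_deficient_topological_measure nu ->
  proper_deficient_topological_measure (fun A => mu A + nu A).
Proof.
move=> pmu pnu; have [[dmu _] [dnu _]] := (pmu, pnu).
split; first exact: dtm_add.
move=> m rm mle; apply: radon_eq0 => // K cK; have mK := compact_borel hX cK.
pose mr : {measure set (borelType X) -> \bar R} := mrestr m mK.
pose a := truncated_dtm m K mu; pose b := truncated_dtm m K nu.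
have [a0 b0] : (forall A, 0 <= a A) /\ (forall A, 0 <= b A).
  by split=> A; exact: truncated_dtm_ge0.
have mr_le_a (B : set (borelType X)) : measurable B -> mr B <= cst 0 B + a B.
  move=> mB; rewrite add0e -[a B]adde0.
  rewrite -(proper_truncated_dtm_eq0 rm cK pnu mB).
  apply: (@le_add_mu_ext _ _ _ mr) => //.
  - exact: truncated_dtm0.
  - exact: superadditive_truncated_dtm.
  - exact: superadditive_truncated_dtm.
  - by move=> A mA; exact: le_truncated_dtmD.
apply/eqP; rewrite eq_le measure_ge0 andbT.
rewrite -[leRHS](proper_truncated_dtm_eq0 rm cK pmu mK) -[leRHS]add0e.
rewrite -[in leLHS](setIid K).
apply: (@le_add_mu_ext _ _ _ mr (cst 0)) => //.
- by move=> A B _ _ _; rewrite adde0.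
- exact: superadditive_truncated_dtm.
Qed.

End dtm.

Theorem theorem4p8 (R : realType) (X : ptopologicalType)
    (X_locally_compact : locally_compact [set: X])
    (X_connected : connected [set: X])
    (X_hausdorff : hausdorff_space X)
    (mu nu : set X -> \bar R)
    (mu_proper : proper_deficient_topological_measure mu)
    (nu_proper : proper_deficient_topological_measure nu) :
  proper_deficient_topological_measure (fun A : set X => mu A + nu A).
Proof. exact: proper_dtm_add. Qed.
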